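(* Let $k\ge 2$, $s\ge 2$, $n\ge 1$ be integers. Let $H$ be the graph with vertex set $\{u_i,v_i:1\le i\le 2k\}\cup\{y_{i,j},z_{i,j}:1\le i\le k,\ 1\le j\le 2n\}$ and edges $u_iv_i$ ($1\le i\le 2k$) and $u_iy_{i,j}$, $v_{2k+1-i}y_{i,j}$, $v_iz_{i,j}$, $u_{2k+1-i}z_{i,j}$ ($1\le i\le k$, $1\le j\le 2n$). Suppose $\{v_1,\dots,v_{2k}\}$ is partitioned into blocks each of size $s$ such that no two vertices in the same block have a common neighbor in $H$, and let $G$ be obtained from $H$ by identifying all vertices of each block into a single vertex. If $G$ is bipartite and every connected component of $G$ has two partite sets of equal size, or $G$ is tripartite (i.e. has chromatic number $3$), then $\chi_{la}(G)=3$.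
   Context: For a graph $G$ with $q$ edges, a local antimagic labeling is a bijection $f:E(G)\to\{1,\dots,q\}$ such that, writing $f^+(u)=\sum_{e\ni u}f(e)$, we have $f^+(u)\ne f^+(v)$ for every edge $uv$. $\chi_{la}(G)$ is the minimum over all local antimagic labelings of the number of distinct values of $f^+$. (The graph $H$ is denoted $G_{k,2}(2n)$ in the paper and the family of such $G$ is $\mathcal J_2(k,2n,s)$.) *)

(* Defs.v *)
From HB Require Import structures.
From mathcomp Require Import all_boot.

Set Implicit Arguments.
Unset Strict Implicit.
Unset Printing Implicit Defensive.

Record sgraph := SGraph {
  vertex :> finType;
  adj : rel vertex;
  adj_sym : symmetric adj;
  adj_irrefl : irreflexive adj
}.

Section Graph.
Variable G : sgraph.

Definition edges : {set {set G}} :=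
  [set [set p.1; p.2] | p : G * G & adj p.1 p.2].

Definition edge := {e : {set G} | e \in edges}.

(* The label of [e] is [(f e).+1], so that labels range over {1, ..., q}. *)
Definition labeling := {ffun edge -> 'I_#|edges|}.

Definition label (f : labeling) (e : edge) : nat := (f e).+1.

Definition bijective_labeling (f : labeling) : bool :=
  injectiveb f && [forall l, l \in codom f].

Definition vsum (f : labeling) (x : G) : nat :=
  \sum_(e : edge | x \in val e) label f e.

Definition local_antimagic (f : labeling) : bool :=
  bijective_labeling f &&
  [forall x : G, forall y : G, adj x y ==> (vsum f x != vsum f y)].

Definition ncolors (f : labeling) : nat := size (undup (codom (vsum f))).

(* The value is 0 when there is no local antimagic labeling; since [ncolors f]
   is positive on a nonempty graph, this never competes with a minimum. *)
Definition chi_la : nat :=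
  if [pick f | local_antimagic f] is Some f0
  then ncolors [arg min_(f < f0 | local_antimagic f) ncolors f]
  else 0.

Definition colorable (m : nat) : bool :=
  [exists c : {ffun G -> 'I_m},
    [forall x : G, forall y : G, adj x y ==> (c x != c y)]].

Lemma ex_colorable : exists m, colorable m.
Proof.
exists #|G|; apply/existsP; exists [ffun x => enum_rank x].
apply/forallP=> x; apply/forallP=> y; apply/implyP=> xy; rewrite !ffunE.
by apply: contraTneq xy => /enum_rank_inj ->; rewrite adj_irrefl.
Qed.

Definition chromatic_number : nat := ex_minn ex_colorable.

Definition stable (A : {set G}) : Prop :=
  forall x y, x \in A -> y \in A -> ~~ adj x y.

Definition partite_sets (C A B : {set G}) : Prop :=
  [/\ A :|: B = C, [disjoint A & B], stable A & stable B].

Definition bipartite : Prop := exists A B, partite_sets [set: G] A B.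

Definition components : {set {set G}} :=
  equivalence_partition (connect (@adj G)) [set: G].

(* The partite sets of a connected bipartite graph are unique up to exchange,
   so the choice of [A] and [B] below is immaterial. *)
Definition balanced_components : Prop :=
  forall C A B, C \in components -> partite_sets C A B -> #|A| = #|B|.

End Graph.

(* Identification of each member of a family [P] of pairwise disjoint sets to a
   single vertex: the vertices are the members of [P] together with the
   singletons of the vertices that [P] does not cover. *)
Section Identify.
Variables (G : sgraph) (P : {set {set G}}).

Definition identify_vertex :=
  {B : {set G} | B \in P :|: [set [set x] | x in ~: cover P]}.

Definition identify_adj : rel identify_vertex := fun B C =>
  (B != C) && [exists x in val B, exists y in val C, adj x y].

Lemma identify_adj_sym : symmetric identify_adj.
Proof.
suff imp B C : identify_adj B C -> identify_adj C B.
  by move=> B C; apply/idP/idP; apply: imp.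
case/andP=> neBC /exists_inP[x Bx /exists_inP[y Cy xy]].
rewrite /identify_adj eq_sym neBC; apply/exists_inP; exists y => //.
by apply/exists_inP; exists x; rewrite // adj_sym.
Qed.

Lemma identify_adj_irrefl : irreflexive identify_adj.
Proof. by move=> B; rewrite /identify_adj eqxx. Qed.

Definition identify : sgraph := SGraph identify_adj_sym identify_adj_irrefl.

End Identify.

(* Indices are 0-based: [rev_ord i] plays the role of 2k + 1 - i, and [low i]
   is the index i <= k seen among 1, ..., 2k. *)
Section GraphH.
Variables k n : nat.

Inductive Hvertex : Type :=
  | U of 'I_(2 * k)
  | V of 'I_(2 * k)
  | Y of 'I_k & 'I_(2 * n)
  | Z of 'I_k & 'I_(2 * n).

Definition Hvertex_code (x : Hvertex) :
    ('I_(2 * k) + 'I_(2 * k)) + ('I_k * 'I_(2 * n) + 'I_k * 'I_(2 * n)) :=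
  match x with
  | U i => inl (inl i)
  | V i => inl (inr i)
  | Y i j => inr (inl (i, j))
  | Z i j => inr (inr (i, j))
  end.

Definition Hvertex_decode
    (c : ('I_(2 * k) + 'I_(2 * k)) + ('I_k * 'I_(2 * n) + 'I_k * 'I_(2 * n))) :
    Hvertex :=
  match c with
  | inl (inl i) => U i
  | inl (inr i) => V i
  | inr (inl (i, j)) => Y i j
  | inr (inr (i, j)) => Z i j
  end.

Lemma Hvertex_codeK : cancel Hvertex_code Hvertex_decode.
Proof. by case. Qed.

HB.instance Definition _ := Finite.copy Hvertex (can_type Hvertex_codeK).

Definition low (i : 'I_k) : 'I_(2 * k) := widen_ord (leq_pmull k (ltn0Sn 1)) i.

Definition Harc (x y : Hvertex) : bool :=
  match x, y with
  | U a, V b => a == b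
  | U a, Y i _ => a == low i
  | V b, Y i _ => b == rev_ord (low i)
  | V b, Z i _ => b == low i
  | U a, Z i _ => a == rev_ord (low i)
  | _, _ => false
  end.

Definition Hadj : rel Hvertex := fun x y => Harc x y || Harc y x.

Lemma Hadj_sym : symmetric Hadj.
Proof. by move=> x y; rewrite /Hadj orbC. Qed.

Lemma Hadj_irrefl : irreflexive Hadj.
Proof. by case. Qed.

Definition graphH : sgraph := SGraph Hadj_sym Hadj_irrefl.

Definition Vset : {set graphH} := [set V i | i : 'I_(2 * k)].

End GraphH.

(* Main.v *)
Require Import Defs.
From mathcomp Require Import all_boot zify.

(* Since distinct vertices of a block have no common neighbor, the edges of [G]
   are those of [H], so it suffices to label [H]. Call row [i] the edges
   [u_i v_i] and [u_i w], [v_(2k+1-i) w], where [w] runs over the common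
   neighbors of [u_i] and [v_(2k+1-i)]. The edges [u_i v_i] get the labels
   1, ..., 2k; the others are matched into pairs of sum q + 2k + 1, one pair for
   each vertex of degree 2. The pairs are cut into 2n blocks of 2k consecutive
   pairs, one pair of each block for each row. Giving [u_i] alternately the low
   and the high label of the pairs makes consecutive blocks add up to a constant;
   in the last block, whose labels form an interval, [u_i] gets the labels of one
   parity, decreasing by 2, which offsets the slope 1 of the labels of [u_i v_i]
   and the slope 1 of the last but one block. So all [u_i] have the same sum, and
   then all [v_i] too. Fewer than three colors are excluded by the chromatic
   number or by counting the labels of a component from both partite sets. *)

Set Implicit Arguments.
Unset Strict Implicit.
Unset Printing Implicit Defensive.

(** * Double counting and lower bounds on the number of colors *)

Lemma sum_incidence (T E : finType) (psi : E -> {set T}) (g : E -> nat)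
    (A : {set T}) :
  \sum_(x in A) \sum_(e | x \in psi e) g e = \sum_e #|A :&: psi e| * g e.
Proof.
rewrite (exchange_big_dep xpredT) //=; apply: eq_bigr => e _.
by rewrite -sum_nat_const; apply: eq_bigl => x; rewrite inE.
Qed.

(** The witness [f] also rules out the default value 0 of [chi_la]. *)
Lemma chi_la_eq (G : sgraph) (f : labeling G) (m : nat) :
  local_antimagic f -> ncolors f <= m ->
  (forall g : labeling G, local_antimagic g -> m <= ncolors g) ->
  chi_la G = m.
Proof.
move=> fP f_le m_le; rewrite /chi_la; case: pickP => [f0 f0P | /(_ f)].
  case: arg_minnP => // g gP gmin; apply/eqP.
  by rewrite eqn_leq (leq_trans (gmin f fP)) // m_le.
by rewrite fP.
Qed.

(** Distinct sums at adjacent vertices make [vsum f] a proper coloring; the color of a vertex is the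
    position of its sum in the list of values. *)
Lemma chromatic_number_le_ncolors (G : sgraph) (f : labeling G) :
  local_antimagic f -> chromatic_number G <= ncolors f.
Proof.
case/andP=> _ /forallP fP; rewrite /chromatic_number.
case: ex_minnP => m _; apply; apply/existsP.
have idx x : index (vsum f x) (undup (codom (vsum f))) < ncolors f.
  by rewrite index_mem mem_undup codom_f.
exists [ffun x => Ordinal (idx x)].
apply/forallP=> x; apply/forallP=> y; apply/implyP=> xy; rewrite !ffunE.
have := implyP (forallP (fP x) y) xy; apply: contraNneq => -[eq_idx].
have mem z : vsum f z \in undup (codom (vsum f)) by rewrite mem_undup codom_f.
by apply/eqP; rewrite -(nth_index 0 (mem x)) eq_idx nth_index.
Qed.

(* If two colors sufficed, they would be the two partite sets of a component;
   both sets receive the total label of its edges, so they have the same size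
   only if the two colors agree. *)
Lemma balanced_ncolors (G : sgraph) (f : labeling G) (x0 y0 : G) :
  balanced_components G -> adj x0 y0 -> local_antimagic f -> 2 < ncolors f.
Proof.
move=> bal xy0 /andP[_ /forallP fP].
have neq x y : adj x y -> vsum f x != vsum f y.
  by move=> xy; apply: (implyP (forallP (fP x) y)).
rewrite ltnNge; apply/negP=> le2.
have two z : (vsum f z == vsum f x0) || (vsum f z == vsum f y0).
  apply: contraTT le2; rewrite negb_or -ltnNge => /andP[za zb].
  suff: size [:: vsum f x0; vsum f y0; vsum f z] <= ncolors f by [].
  apply: uniq_leq_size => [|c].
    by rewrite /= !inE !negb_or neq //= ![_ == vsum f z]eq_sym za zb.
  by rewrite mem_undup !inE => /or3P[]/eqP->; apply: codom_f.
(* [C] is the component of [x0] and [K c] its vertices of sum [c]; the classes of the sums at [x0]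
   and [y0] are its partite sets. *)
pose C := [set z | connect (@adj G) x0 z].
pose K c := [set z in C | vsum f z == c].
have Cadj x y : adj x y -> (x \in C) = (y \in C).
  move=> xy; rewrite !inE; apply/idP/idP=> h; apply: (connect_trans h).
    exact: connect1.
  by apply: connect1; rewrite adj_sym.
have stabK c : stable (K c).
  move=> x y; rewrite !inE => /andP[_ /eqP xc] /andP[_ /eqP yc].
  by apply/negP => /neq; rewrite xc yc eqxx.
have CP : C \in components G.
  by apply/imsetP; exists x0; rewrite ?inE //; apply/setP => z; rewrite !inE.
have parts : partite_sets C (K (vsum f x0)) (K (vsum f y0)).
  split; [apply/setP=> z | | exact: stabK | exact: stabK].
    by rewrite !inE -andb_orr two andbT.
  rewrite -setI_eq0; apply/eqP/setP=> z; rewrite !inE; apply/negP.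
  case/andP=> /andP[_ /eqP zx] /andP[_ /eqP zy].
  by have := neq _ _ xy0; rewrite -zx -zy eqxx.
have cardK : #|K (vsum f x0)| = #|K (vsum f y0)| := bal _ _ _ CP parts.
have sumK c : \sum_(z in K c) vsum f z = #|K c| * c.
  by rewrite -sum_nat_const; apply: eq_bigr => z; rewrite !inE => /andP[_ /eqP].
have Kend c x y : adj x y -> #|K c :&: [set x; y]| = (x \in K c) + (y \in K c).
  move=> xy; have nxy : x != y by apply: contraTneq xy => ->; rewrite adj_irrefl.
  rewrite setIUr cardsU.
  have E z : #|K c :&: [set z]| = (z \in K c).
    case zK: (z \in K c).
      by rewrite (setIidPr _) ?cards1 // sub1set.
    by apply/eqP; rewrite cards_eq0 setI_eq0 disjoint_sym disjoints1 zK.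
  rewrite !E -setIIr [_ :&: [set y]](_ : _ = set0) ?setI0 ?cards0 ?subn0 //.
  by apply/eqP; rewrite setI_eq0 disjoints1 inE.
(* An edge inside [C] has exactly one end in each class and an edge outside has none, so both sides
   count each label equally often. *)
have eqsum : #|K (vsum f x0)| * vsum f x0 = #|K (vsum f y0)| * vsum f y0.
  rewrite -!sumK !sum_incidence; apply: eq_bigr => e _; congr (_ * _).
  have /imsetP[[x y]] := valP e; rewrite inE /= => xy ->.
  have Kx z c : (z \in K c) = (z \in C) && (vsum f z == c) by rewrite inE.
  rewrite !Kend // !Kx -!(Cadj _ _ xy); have := neq _ _ xy.
  have := negPf (neq _ _ xy0); rewrite eq_sym => ne0.
  case/orP: (two x) => /eqP->; case/orP: (two y) => /eqP->; rewrite ?eqxx //;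
    by rewrite ?(eq_sym (vsum f x0)) ne0 ?andbF ?addn0.
have := neq _ _ xy0; rewrite -(eqn_pmul2l (m := #|K (vsum f x0)|)).
  by rewrite eqsum cardK eqxx.
by rewrite card_gt0; apply/set0Pn; exists x0; rewrite !inE connect0 eqxx.
Qed.

(** * Labelings from an enumeration of the edges *)

(** Injectivity and the bound force [g] to take every value below [#|E|], so a labeling can be given
    by formulas on an explicit index type [E]. *)
Lemma enumerated_labeling (G : sgraph) (E : finType) (phi : E -> {set G})
    (g : E -> nat) :
  injective phi -> edges G = [set phi e | e : E] ->
  injective g -> (forall e, g e < #|E|) ->
  exists f : labeling G,
    bijective_labeling f /\
    forall x, vsum f x = \sum_(e | x \in phi e) (g e).+1.
Proof.
move=> phi_inj edgesE g_inj g_lt.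
have cardE : #|E| = #|edges G| by rewrite edgesE card_imset.
have phiP e : phi e \in edges G by rewrite edgesE imset_f.
pose phi' e : edge G := exist _ (phi e) (phiP e).
have phi'_inj : injective phi' by move=> e e' [] /phi_inj.
have card_edge : #|{: edge G}| = #|edges G| by rewrite card_sig.
have phi'_bij : bijective phi'.
  by apply: inj_card_bij => //; rewrite card_edge cardE.
have [psi phiK psiK] := phi'_bij.
pose f : labeling G := [ffun e => cast_ord cardE (Ordinal (g_lt (psi e)))].
have f_inj : injective f.
  move=> e e'; rewrite !ffunE => /(congr1 val) /= /g_inj.
  exact: (can_inj psiK).
exists f; split.
  apply/andP; split; first exact/injectiveP.
  apply/forallP=> l; apply: inj_card_onto => //.
  by rewrite card_edge card_ord.
move=> x; rewrite /vsum (reindex phi') /=; last exact: onW_bij.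
by apply: eq_bigr => e _; rewrite /label ffunE /= phiK.
Qed.

(** * Edges and vertex sums under identification of vertices *)

Section Projection.
Variables (G : sgraph) (P : {set {set G}}).

(** [pblock] returns the empty set outside [cover P], hence the separate singleton case. *)
Definition class (x : G) : {set G} :=
  if x \in cover P then pblock P x else [set x].

Lemma class_subproof x : class x \in P :|: [set [set y] | y in ~: cover P].
Proof.
rewrite /class inE; case: ifPn => xP; first by rewrite pblock_mem.
by rewrite orbC imset_f // inE.
Qed.

Definition proj (x : G) : identify P := exist _ (class x) (class_subproof x).

Hypothesis tiP : trivIset P.
Hypothesis stable_cover : stable (cover P).

Lemma mem_class x : x \in class x.
Proof. by rewrite /class; case: ifP => xP; rewrite ?mem_pblock ?xP ?inE. Qed.

(** The vertices of the quotient are pairwise disjoint sets, so each is determined by any of its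
    elements. *)
Lemma mem_val_identify (B : identify P) x : (x \in val B) = (B == proj x).
Proof.
apply/idP/eqP => [xB | ->]; last exact: mem_class.
apply: val_inj; move: xB; rewrite /= /class.
have := valP B; rewrite inE => /orP[BP xB|/imsetP[y]].
  rewrite ifT; first by rewrite (def_pblock tiP BP xB).
  by apply/bigcupP; exists (val B).
by rewrite inE => /negPf yP ->; rewrite inE => /eqP->; rewrite yP.
Qed.

Lemma eq_proj x y :
  proj x = proj y -> x = y \/ exists2 B, B \in P & x \in B /\ y \in B.
Proof.
move=> eq_xy; have : y \in val (proj x) by rewrite mem_val_identify eq_xy.
rewrite /= /class; case: ifP => xP; last by rewrite inE => /eqP->; left.
by right; exists (pblock P x); rewrite ?pblock_mem ?mem_pblock.
Qed.

Lemma mem_coverP (B : {set G}) x : B \in P -> x \in B -> x \in cover P.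
Proof. by move=> BP xB; apply/bigcupP; exists B. Qed.

Lemma adj_proj_neq x y : adj x y -> proj x != proj y.
Proof.
move=> xy; apply: contraTneq xy => /eq_proj[-> | [B BP [xB yB]]].
  by rewrite adj_irrefl.
by apply: stable_cover; apply: mem_coverP BP _.
Qed.

Lemma adj_proj x y : adj x y -> adj (proj x) (proj y).
Proof.
move=> xy; rewrite /adj /= /identify_adj adj_proj_neq //=.
apply/exists_inP; exists x; first exact: mem_class.
by apply/exists_inP; exists y; first exact: mem_class.
Qed.

Lemma adj_identify (B C : identify P) :
  adj B C -> exists x y, [/\ B = proj x, C = proj y & adj x y].
Proof.
case/andP=> _ /exists_inP[x]; rewrite mem_val_identify => /eqP-> /exists_inP[y].
by rewrite mem_val_identify => /eqP-> xy; exists x, y.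
Qed.

Lemma imset_proj2 x y : proj @: [set x; y] = [set proj x; proj y].
Proof. by rewrite imsetU1 imset_set1. Qed.

Lemma edges_identify :
  edges (identify P) = [set proj @: (e : {set G}) | e in edges G].
Proof.
apply/setP=> E; apply/imsetP/imsetP => [[[B C]] | [e /imsetP[[x y]]]].
  rewrite inE => /adj_identify[x [y [/= -> -> xy]]] ->.
  exists [set x; y]; last by rewrite imset_proj2.
  by apply/imsetP; exists (x, y); rewrite ?inE.
rewrite inE /= => xy -> ->; exists (proj x, proj y); rewrite ?imset_proj2 //.
by rewrite inE; apply: adj_proj.
Qed.

(** The ends of an edge have different images, so a class contains at most one of them. *)
Lemma card_val_edge (B : identify P) (e : {set G}) :
  e \in edges G -> #|val B :&: e| = (B \in proj @: e).
Proof.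
case/imsetP=> -[x y]; rewrite inE /= => xy ->; rewrite imset_proj2 !inE.
have -> : val B :&: [set x; y] =
    [set z in [set x; y] | B == proj z].
  by apply/setP=> z; rewrite !inE mem_val_identify andbC.
have xy' : x != y by apply: contraTneq xy => ->; rewrite adj_irrefl.
have pxy := adj_proj_neq xy.
have one z : z \in [set x; y] -> B = proj z ->
    [set z in [set x; y] | B == proj z] = [set z].
  move=> zxy ->; apply/setP=> w; rewrite !inE.
  apply/andP/eqP=> [[wxy /eqP zw] | ->].
    move: zxy; rewrite inE => zxy; move: pxy wxy zxy.
    by rewrite !inE => pxy /orP[] /eqP ? /orP[] /eqP ?; subst=> //;
       rewrite zw eqxx in pxy.
  by move: zxy; rewrite !inE.
have [Bx | Bx] := eqVneq B (proj x).
  by rewrite (one x) ?inE ?eqxx // cards1.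
have [By | By] := eqVneq B (proj y).
  by rewrite (one y) ?inE ?eqxx ?orbT // cards1.
apply/eqP; rewrite cards_eq0; apply/eqP/setP => z; rewrite !inE.
by apply/negP=> /andP[/orP[]/eqP->]; apply/negP.
Qed.

Hypothesis no_common_neighbor : forall B x y, B \in P -> x \in B -> y \in B ->
  x != y -> ~ exists z : G, adj x z /\ adj y z.

(** If only one end changes, its two values lie in one block and have the other end as a common
    neighbor; if both change, an edge joins two vertices of [cover P]. *)
Lemma proj_adj_inj x y x' y' : adj x y -> adj x' y' ->
  proj x = proj x' -> proj y = proj y' -> x = x' /\ y = y'.
Proof.
move=> xy xy' /eq_proj[eqx | [B BP [xB xB']]] /eq_proj[eqy | [C CP [yC yC']]].
- by [].
- subst x'; split=> //; apply/eqP; apply: contraT => ny.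
  case: (no_common_neighbor CP yC yC' ny).
  by exists x; rewrite adj_sym xy adj_sym.
- subst y'; split=> //; apply/eqP; apply: contraT => nx.
  by case: (no_common_neighbor BP xB xB' nx); exists y.
- by have := stable_cover (mem_coverP BP xB) (mem_coverP CP yC); rewrite xy.
Qed.

Lemma imset_proj_edge_inj :
  {in edges G &, injective (fun e : {set G} => proj @: e)}.
Proof.
move=> e e' /imsetP[[x y]]; rewrite inE /= => xy ->.
case/imsetP=> -[x' y']; rewrite inE /= => xy' ->.
rewrite !imset_proj2 => eq_e.
have : proj x \in [set proj x'; proj y'] by rewrite -eq_e set21.
have : proj y \in [set proj x'; proj y'] by rewrite -eq_e set22.
have := adj_proj_neq xy; rewrite !inE.
(* The ends may correspond in either order; both going to the same end contradicts [n]. *)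
move=> n /orP[] /eqP ey /orP[] /eqP ex; rewrite ?ex ?ey ?eqxx // in n.
- rewrite adj_sym in xy'.
  by have [-> ->] := proj_adj_inj xy xy' ex ey; rewrite setUC.
- by have [-> ->] := proj_adj_inj xy xy' ex ey.
Qed.

(** No two edges are merged and none collapses, so a labeling of [G] carries over and the sums at
    identified vertices add up. *)
Lemma identify_labeling (E : finType) (psi : E -> {set G}) (g : E -> nat) :
  injective psi -> edges G = [set psi e | e : E] ->
  injective g -> (forall e, g e < #|E|) ->
  exists f : labeling (identify P),
    bijective_labeling f /\
    forall B, vsum f B = \sum_(x in val B) \sum_(e | x \in psi e) (g e).+1.
Proof.
move=> psi_inj edgesE g_inj g_lt.
have psiP e : psi e \in edges G by rewrite edgesE imset_f.
have [||//|//|f [f_bij fE]] :=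
    @enumerated_labeling (identify P) E (fun e => proj @: psi e) g.
- by move=> e e' /imset_proj_edge_inj eqe; apply: psi_inj; apply: eqe.
- by rewrite edges_identify edgesE -imset_comp.
exists f; split=> // B; rewrite fE sum_incidence big_mkcond.
by apply: eq_bigr => e _; rewrite card_val_edge //; case: ifP; rewrite ?mul1n.
Qed.

End Projection.

(** * Arithmetic of the row labels *)

Lemma sum_pairs (F : nat -> nat) n :
  \sum_(c < 2 * n) F c = \sum_(j < n) (F (2 * j) + F (2 * j).+1).
Proof.
elim: n => [|n IHn]; first by rewrite !big_ord0.
by rewrite mulnS !add2n 2!big_ord_recr big_ord_recr /= IHn addnA.
Qed.

Section Labels.
Variables m n : nat.
Let M := m * (2 * n).

(* 0-based labels, for a 0-based row [i] and a 0-based block [c], of the edges at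
   the degree-2 vertex ending at [u_i] and at [v_(2k+1-i)]; here m = 2k. *)
Definition ulabel (i c : nat) : nat :=
  if odd c then
    if c == (2 * n).-1 then M + 2 * m - 1 - 2 * i else 2 * M + m - 1 - (m * c + i)
  else m + (m * c + i).

Definition vlabel (i c : nat) : nat := 2 * M + 2 * m - 1 - ulabel i c.

(** Outside the last block the low label [m + (m * c + i)] is below [M], hence its high partner is
    at least [M + 2 * m]; the interval in between is left to the last block. *)
Lemma block_bound i c : i < m -> c < 2 * n ->
  (c = (2 * n).-1 /\ odd c) \/ m * c + i + m < M.
Proof.
move=> im cn; have [->|ne] := eqVneq c (2 * n).-1; first by left; split; lia.
have /(leq_mul (leqnn m)) : c.+2 <= 2 * n by lia.
by rewrite /M !mulnS => h; right; lia.
Qed.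

Lemma block_inj i c i' c' : i < m -> i' < m ->
  m * c + i = m * c' + i' -> c = c' /\ i = i'.
Proof.
move=> im im' eq_t; have m0 : 0 < m by lia.
have cc : c = c'.
  have := congr1 (divn^~ m) eq_t; rewrite ![m * _]mulnC !divnMDl //.
  by rewrite !divn_small // !addn0.
by subst c'; split=> //; lia.
Qed.

Lemma ulabel_bound i c : i < m -> c < 2 * n ->
  m <= ulabel i c < 2 * M + m.
Proof.
move=> im cn; have [[-> oc] | lt] := block_bound im cn; rewrite /ulabel.
  rewrite oc eqxx; have : m <= M by rewrite leq_pmulr //; lia.
  lia.
have -> : (c == (2 * n).-1) = false.
  by apply/negP=> /eqP ec; move: lt; rewrite ec /M -subn1 mulnBr; lia.
by case: odd; lia.
Qed.

Lemma label_sum i c : i < m -> c < 2 * n ->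
  (ulabel i c).+1 + (vlabel i c).+1 = 2 * M + 2 * m + 1.
Proof. by move=> im cn; have := ulabel_bound im cn; rewrite /vlabel; lia. Qed.

Lemma label_inj i c i' c' (b b' : bool) :
  i < m -> i' < m -> c < 2 * n -> c' < 2 * n ->
  (if b then ulabel i c else vlabel i c) =
  (if b' then ulabel i' c' else vlabel i' c') ->
  [/\ i = i', c = c' & b = b'].
Proof.
move=> im im' cn cn'; rewrite /vlabel /ulabel.
have mM : m <= M by rewrite leq_pmulr //; lia.
have ne d j : m * d + j + m < M -> (d == (2 * n).-1) = false.
  by move=> lt; apply/negP=> /eqP ec; move: lt; rewrite ec /M -subn1 mulnBr; lia.
have [[-> ->] | lt] := block_bound im cn;
  have [[-> ->] | lt'] := block_bound im' cn'; rewrite ?eqxx.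
(* In the last block the labels are [M + 2 * m - 1 - 2 * i] on the [u] side and [M + 2 * i] on the
   [v] side, so parity separates the sides. *)
- by case: b b' => [] [] eq_l; split=> //; lia.
- by rewrite (ne _ _ lt'); case: b b' (odd c') => [] [] [] eq_l; exfalso; lia.
- by rewrite (ne _ _ lt); case: b b' (odd c) => [] [] [] eq_l; exfalso; lia.
rewrite (ne _ _ lt) (ne _ _ lt') => eq_l.
(* Low labels lie below [M] and high ones above the interval of the last block, so equal labels
   belong to the same pair. *)
have eq_t : m * c + i = m * c' + i'.
  by move: eq_l; case: b b' (odd c) (odd c') => [] [] [] []; lia.
have [ec ei] := block_inj im im' eq_t; subst c' i'; split=> //.
by move: eq_l; case: b b' (odd c) => [] [] [] //; lia.
Qed.

(** Blocks [2 * j] and [2 * j + 1] together give [2 * M + m + 1], except that the last two blocks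
    give [i] less; the label [i.+1] of [u_i v_i] restores this and adds 1. *)
Lemma sum_ulabel i : i < m -> 0 < n ->
  i.+1 + \sum_(c < 2 * n) (ulabel i c).+1 = n * (2 * M + m + 1) + 1.
Proof.
move=> im n0; rewrite (sum_pairs (fun c => (ulabel i c).+1)).
have nE : n = n.-1.+1 by rewrite prednK.
rewrite [in \sum_(_ < n) _]nE big_ord_recr /=.
rewrite (eq_bigr (fun => 2 * M + m + 1)) => [|j _].
  rewrite sum_nat_const card_ord /ulabel /= !oddM /=.
  have -> : ((2 * n.-1).+1 == (2 * n).-1) = true by lia.
  have ME : M = m * (2 * n.-1) + 2 * m by rewrite /M [in LHS]nE; lia.
  rewrite [X in _ = X * _ + _]nE [n.-1.+1 * _]mulSn.
  by move: (n.-1 * _) (m * (2 * n.-1)) ME => s t ME; lia.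
have jn := ltn_ord j; rewrite /ulabel /= !oddM /=.
have -> : ((2 * j).+1 == (2 * n).-1) = false by lia.
have : m * (2 * j).+1 + i + m < M.
  have /(leq_mul (leqnn m)) : (2 * j).+3 <= 2 * n by lia.
  by rewrite /M !mulnS; lia.
by rewrite mulnS; lia.
Qed.

End Labels.

(** * Rows of H, its edges and its vertex sums *)

Section GraphHLabeling.
Variables k n : nat.
Local Notation H := (graphH k n).

Lemma half_subproof (i : 'I_(2 * k)) : minn i (rev_ord i) < k.
Proof. by have := ltn_ord i; rewrite /=; lia. Qed.

(** The rows [i] and [rev_ord i] share this index: the row below [k] uses the vertices [Y], the
    other one [Z]. *)
Definition half (i : 'I_(2 * k)) : 'I_k := Ordinal (half_subproof i).

(* The vertices of degree 2, indexed so that [W i c] is adjacent to [U i] and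
   [V (rev_ord i)] for every [i]. *)
Definition W (i : 'I_(2 * k)) (c : 'I_(2 * n)) : Hvertex k n :=
  if i < k then Y (half i) c else Z (half i) c.

Lemma Y_W a c : Y a c = W (low a) c.
Proof.
rewrite /W /= ltn_ord; congr (Y _ c); apply: val_inj => /=.
by have := ltn_ord a; lia.
Qed.

Lemma Z_W a c : Z a c = W (rev_ord (low a)) c.
Proof.
have := ltn_ord a; rewrite /W /= => ak; rewrite ifF; last by lia.
by congr (Z _ c); apply: val_inj => /=; lia.
Qed.

Lemma W_ind (T : Hvertex k n -> Prop) :
  (forall i, T (U _ i)) -> (forall i, T (V _ i)) -> (forall i c, T (W i c)) ->
  forall x, T x.
Proof. by move=> TU TV TW [i|i|a c|a c]; rewrite ?Y_W ?Z_W. Qed.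

Lemma low_half (i : 'I_(2 * k)) :
  low (half i) = if i < k then i else rev_ord i.
Proof.
have := ltn_ord i; case: (ltnP i k) => ik im; apply: val_inj => /=; lia.
Qed.

Lemma W_inj i c i' c' : W i c = W i' c' -> i = i' /\ c = c'.
Proof.
have := low_half i; have := low_half i'; rewrite /W.
case: (ltnP i' k) => _ hi'; case: (ltnP i k) => _ hi // [hh ->]; split=> //;
  have {}hh : half i = half i' by apply: val_inj.
  by rewrite -hi hh.
by apply: rev_ord_inj; rewrite -hi hh.
Qed.

Lemma adj_UV i j : @Hadj k n (U _ i) (V _ j) = (i == j).
Proof. by rewrite /Hadj /= orbF. Qed.

Lemma adj_UW i j c : @Hadj k n (U _ i) (W j c) = (i == j).
Proof.
have := low_half j; rewrite /Hadj /W; case: ifP => _ /= ->.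
  by rewrite orbF.
by rewrite rev_ordK orbF.
Qed.

Lemma adj_VW i j c : @Hadj k n (V _ i) (W j c) = (i == rev_ord j).
Proof.
have := low_half j; rewrite /Hadj /W; case: ifP => _ /= ->.
  by rewrite orbF.
by rewrite orbF.
Qed.

Lemma adj_WW i c j d : @Hadj k n (W i c) (W j d) = false.
Proof. by rewrite /Hadj /W; do 2!case: ifP. Qed.

Lemma adj_UU i j : @Hadj k n (U _ i) (U _ j) = false. Proof. by []. Qed.
Lemma adj_VV i j : @Hadj k n (V _ i) (V _ j) = false. Proof. by []. Qed.

Definition Hindex : finType :=
  ('I_(2 * k) + 'I_(2 * k) * 'I_(2 * n) * bool)%type.

Definition Hends (e : Hindex) : {set H} :=
  match e with
  | inl i => [set (U _ i : H); V _ i]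
  | inr (i, c, true) => [set (U _ i : H); W i c]
  | inr (i, c, false) => [set (V _ (rev_ord i) : H); W i c]
  end.

Definition Hlabel (e : Hindex) : nat :=
  match e with
  | inl i => i
  | inr (i, c, b) => if b then ulabel (2 * k) n i c else vlabel (2 * k) n i c
  end.

Lemma eqUU i j : (U _ i == U _ j :> H) = (i == j).
Proof. by apply/eqP/eqP => [[] | ->]. Qed.
Lemma eqVV i j : (V _ i == V _ j :> H) = (i == j).
Proof. by apply/eqP/eqP => [[] | ->]. Qed.
Lemma eqUV i j : (U _ i == V _ j :> H) = false.
Proof. by apply/eqP. Qed.
Lemma eqUW i j c : (U _ i == W j c :> H) = false.
Proof. by apply/eqP; rewrite /W; case: ifP. Qed.
Lemma eqVW i j c : (V _ i == W j c :> H) = false.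
Proof. by apply/eqP; rewrite /W; case: ifP. Qed.
Lemma eqWW i c j d : (W i c == W j d :> H) = (i == j) && (c == d).
Proof. by apply/eqP/andP => [/W_inj[-> ->] | [/eqP-> /eqP->]]. Qed.

Lemma mem_Hends_U i e : ((U _ i : H) \in Hends e) =
  match e with inl j => i == j | inr (j, _, b) => b && (i == j) end.
Proof.
by case: e => [j | [[j c] []]] /=; rewrite !inE ?eqUU ?eqUV ?eqUW ?orbF.
Qed.

Lemma mem_Hends_V i e : ((V _ i : H) \in Hends e) =
  match e with inl j => i == j | inr (j, _, b) => ~~ b && (i == rev_ord j) end.
Proof.
by case: e => [j | [[j c] []]] /=;
  rewrite !inE ?[_ == U _ _]eq_sym ?eqVV ?eqUV ?eqVW ?orbF.
Qed.

Lemma mem_Hends_W i c e : ((W i c : H) \in Hends e) =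
  match e with inl j => false | inr (j, d, _) => (i == j) && (c == d) end.
Proof.
by case: e => [j | [[j d] []]] /=;
  rewrite !inE ?[_ == U _ _]eq_sym ?[_ == V _ _]eq_sym ?eqUW ?eqVW ?eqWW.
Qed.

Arguments Hends : simpl never.

Lemma Hends_inj : injective Hends.
Proof.
move=> e e' ee.
have {ee} mem x : (x \in Hends e) = (x \in Hends e') by rewrite ee.
case: e e' mem => [i | [[i c] b]] [i' | [[i' c'] b']] mem.
- by have := mem (U _ i); rewrite !mem_Hends_U eqxx => /esym/eqP->.
- by have := mem (W i' c'); rewrite !mem_Hends_W !eqxx.
- by have := mem (W i c); rewrite !mem_Hends_W !eqxx.
(* The end of degree 2 determines [i] and [c]; membership of [U i] then decides the boolean. *)
have := mem (W i c); rewrite !mem_Hends_W !eqxx => /esym/andP[/eqP ei /eqP ec].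
subst i' c'; have := mem (U _ i); rewrite !mem_Hends_U eqxx !andbT.
by move->.
Qed.

Lemma edges_graphH : edges H = [set Hends e | e : Hindex].
Proof.
apply/setP=> E; apply/imsetP/imsetP => [[[x y]] | [e _ ->]]; last first.
  case: e => [i | [[i c] []]]; rewrite /Hends.
  - by exists (U _ i, V _ i); rewrite // inE /= adj_UV.
  - by exists (U _ i, W i c); rewrite // inE /= adj_UW.
  - by exists (V _ (rev_ord i), W i c); rewrite // inE /= adj_VW.
rewrite inE /= => xy ->; move: xy.
elim/W_ind: x => [i | i | i c]; elim/W_ind: y => [j | j | j d].
- by rewrite adj_UU.
- by rewrite adj_UV => /eqP->; exists (inl j).
- by rewrite adj_UW => /eqP->; exists (inr (j, d, true)).
- by rewrite Hadj_sym adj_UV => /eqP->; exists (inl i); rewrite //= setUC.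
- by rewrite adj_VV.
- by rewrite adj_VW => /eqP->; exists (inr (j, d, false)).
- rewrite Hadj_sym adj_UW => /eqP->.
  by exists (inr (i, c, true)); rewrite //= setUC.
- rewrite Hadj_sym adj_VW => /eqP->.
  by exists (inr (i, c, false)); rewrite //= setUC.
- by rewrite adj_WW.
Qed.

Lemma card_Hindex : #|Hindex| = 2 * (2 * k * (2 * n)) + 2 * k.
Proof. by rewrite card_sum !card_prod card_bool !card_ord; lia. Qed.

Lemma vlabel_bound (i : 'I_(2 * k)) (c : 'I_(2 * n)) :
  2 * k <= vlabel (2 * k) n i c < 2 * (2 * k * (2 * n)) + 2 * k.
Proof.
by have := ulabel_bound (ltn_ord i) (ltn_ord c); rewrite /vlabel; lia.
Qed.

Lemma Hlabel_lt e : Hlabel e < #|Hindex|.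
Proof.
rewrite card_Hindex; case: e => [i | [[i c] []]] /=.
- by have := ltn_ord i; lia.
- by case/andP: (ulabel_bound (ltn_ord i) (ltn_ord c)).
- by case/andP: (vlabel_bound i c).
Qed.

Lemma Hlabel_ge i c b : 2 * k <= Hlabel (inr (i, c, b)).
Proof.
case: b => /=; first by case/andP: (ulabel_bound (ltn_ord i) (ltn_ord c)).
by case/andP: (vlabel_bound i c).
Qed.

Lemma Hlabel_inj : injective Hlabel.
Proof.
case=> [i | [[i c] b]] [i' | [[i' c'] b']].
- by move=> /= /val_inj->.
- by have := Hlabel_ge i' c' b'; rewrite leqNgt => /negP + e; rewrite -e ltn_ord.
- by have := Hlabel_ge i c b; rewrite leqNgt => /negP + e; rewrite e ltn_ord.
by move=> /= /label_inj[] // /val_inj-> /val_inj-> ->.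
Qed.

Definition Hsum (x : H) : nat := \sum_(e | x \in Hends e) (Hlabel e).+1.

Lemma sum_Hindex (p : pred Hindex) (F : Hindex -> nat) :
  \sum_(e | p e) F e = \sum_(i | p (inl i)) F (inl i) +
    \sum_i \sum_c \sum_(b | p (inr (i, c, b))) F (inr (i, c, b)).
Proof.
rewrite big_sumType /=; congr (_ + _).
rewrite pair_bigA pair_big_dep /=.
by apply: eq_big => [[[i c] b]|[[i c] b] _].
Qed.

Local Notation q := (2 * (2 * k * (2 * n)) + 2 * k).

Lemma Hsum_U i : 0 < n -> Hsum (U _ i) = n * (q + 1) + 1.
Proof.
move=> n0; rewrite /Hsum sum_Hindex.
under eq_bigl do rewrite mem_Hends_U eq_sym.
rewrite big_pred1_eq -(sum_ulabel (ltn_ord i) n0) /=; congr (_ + _).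
rewrite (bigD1 i) //= [X in _ + X]big1 ?addn0 => [|j ji].
  apply: eq_bigr => c _; rewrite big_mkcond big_bool.
  by rewrite !mem_Hends_U eqxx /= addn0.
rewrite big1 // => c _; rewrite big_pred0 // => b.
by rewrite mem_Hends_U eq_sym (negPf ji) andbF.
Qed.

(** The sum is the label [i.+1] plus the pairs of row [rev_ord i] less their [u] side. By
    [sum_ulabel] this brings in the label [(rev_ord i).+1], and the two labels add up to
    [2 * k + 1], so [i] cancels. *)
Lemma Hsum_V i : 0 < n -> Hsum (V _ i) = n * (q + 1) + 2 * k * (2 * n) + 2 * k.
Proof.
move=> n0; rewrite /Hsum sum_Hindex.
under eq_bigl do rewrite mem_Hends_V eq_sym.
rewrite big_pred1_eq (bigD1 (rev_ord i)) //= [X in _ + (_ + X)]big1 ?addn0; last first.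
  move=> j ji; rewrite big1 // => c _; rewrite big_pred0 // => b.
  rewrite mem_Hends_V andbC; apply/negP => /andP[/eqP ij].
  by rewrite ij rev_ordK eqxx in ji.
have -> : \sum_c \sum_(b | (V _ i : H) \in Hends (inr (rev_ord i, c, b)))
    (Hlabel (inr (rev_ord i, c, b))).+1 =
  \sum_(c < 2 * n) (vlabel (2 * k) n (rev_ord i) c).+1.
  apply: eq_bigr => c _; rewrite big_mkcond big_bool.
  by rewrite !mem_Hends_V rev_ordK eqxx.
have := sum_ulabel (ltn_ord (rev_ord i)) n0.
have : \sum_(c < 2 * n) (ulabel (2 * k) n (rev_ord i) c).+1 +
    \sum_(c < 2 * n) (vlabel (2 * k) n (rev_ord i) c).+1 =
    2 * n * (q + 2 * k + 1).
  rewrite -big_split /= (eq_bigr (fun => q + 2 * k + 1)) => [|c _].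
    by rewrite sum_nat_const card_ord.
  by rewrite (label_sum (ltn_ord (rev_ord i)) (ltn_ord c)); lia.
have := ltn_ord i; rewrite /=; lia.
Qed.

Lemma Hsum_W i c : Hsum (W i c) = q + 2 * k + 1.
Proof.
rewrite /Hsum sum_Hindex big_pred0 ?add0n => [|j]; last by rewrite mem_Hends_W.
rewrite (bigD1 i) //= [X in _ + X]big1 ?addn0 => [|j ji]; last first.
  rewrite big1 // => d _; rewrite big_pred0 // => b.
  by rewrite mem_Hends_W eq_sym (negPf ji).
rewrite (bigD1 c) //= [X in _ + X]big1 ?addn0 => [|d dc]; last first.
  rewrite big_pred0 // => b.
  by rewrite mem_Hends_W [c == d]eq_sym (negPf dc) andbF.
rewrite big_mkcond big_bool !mem_Hends_W !eqxx /=.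
by rewrite (label_sum (ltn_ord i) (ltn_ord c)); lia.
Qed.

End GraphHLabeling.

(** * The three colors on the quotient and their minimality *)

Theorem theorem2p12 (k s n : nat) (hk : 2 <= k) (hs : 2 <= s) (hn : 1 <= n)
    (P : {set {set graphH k n}})
    (hP : partition P (Vset k n))
    (hsize : forall B, B \in P -> #|B| = s)
    (hnbr : forall B x y, B \in P -> x \in B -> y \in B -> x != y ->
       ~ exists z : graphH k n, adj x z /\ adj y z) :
  (bipartite (identify P) /\ balanced_components (identify P)) \/
  chromatic_number (identify P) = 3 ->
  chi_la (identify P) = 3.
Proof.
case/and3P: hP => /eqP coverP tiP set0P.
have stabP : stable (cover P).
  by rewrite coverP => x y /imsetP[i _ ->] /imsetP[j _ ->].
have [f [f_bij fE]] := identify_labeling tiP stabP hnbr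
  (@Hends_inj k n) (edges_graphH k n) (@Hlabel_inj k n) (@Hlabel_lt k n).
pose q := 2 * (2 * k * (2 * n)) + 2 * k.
(* [a], [b] and [c] are the sums in H at the [u_i], the [v_i] and the vertices of degree 2; a block
   of [s] vertices [v_i] gets [s * b]. *)
pose a := n * (q + 1) + 1.
pose b := n * (q + 1) + 2 * k * (2 * n) + 2 * k.
pose c := q + 2 * k + 1.
pose color (x : Hvertex k n) :=
  match x with U _ => a | V _ => s * b | _ => c end.
have fproj x : vsum f (proj P x) = color x.
  rewrite fE /= /class coverP; case: ifPn => [xV | xV].
    have xP : pblock P x \in P by rewrite pblock_mem ?coverP.
    rewrite (eq_bigr (fun => b)) => [|y yx].
      rewrite sum_nat_const (hsize _ xP).
      by move: xV => /imsetP[i _ ->].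
    have : y \in Vset k n by rewrite -coverP; apply: mem_coverP xP yx.
    by case/imsetP=> i _ ->; apply: Hsum_V.
  rewrite big_set1; move: xV; rewrite -/(Hsum x).
  case: x => [i|i|i j|i j] xV.
  - exact: Hsum_U.
  - by rewrite imset_f in xV.
  - by rewrite Y_W Hsum_W -Y_W.
  - by rewrite Z_W Hsum_W -Z_W.
have projP (B : identify P) : exists x, B = proj P x.
  have [x xB] : exists x, x \in val B.
    apply/set0Pn; have := valP B; rewrite inE => /orP[BP | /imsetP[x _ ->]].
      by apply: contraNneq set0P => <-.
    by apply/set0Pn; exists x; rewrite inE.
  by exists x; apply/eqP; rewrite -mem_val_identify.
have kn : k <= k * n by rewrite leq_pmulr.
have qn : q <= n * q by rewrite leq_pmull.
have ab : a < b by rewrite /a /b; lia.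
have cb : c < s * b.
  have : 2 * b <= s * b by rewrite leq_mul2r hs orbT.
  by rewrite /b /c; lia.
have asb : a < s * b.
  by apply: (leq_trans ab); rewrite leq_pmull //; lia.
have ac : a != c.
  (* For [n = 1] the values are [q + 2] and [q + 2 * k + 1]; for larger [n], [a] exceeds [2 * q],
     which is at least [c]. *)
  rewrite /a /c; have [-> | n2] : n = 1 \/ 1 < n by lia.
    by lia.
  have : 2 * q <= n * q by rewrite leq_mul2r n2 orbT.
  by rewrite /q; nia.
have f_la : local_antimagic f.
  apply/andP; split=> //; apply/forallP=> B; apply/forallP=> C.
  apply/implyP=> /(adj_identify tiP)[x [y [-> -> ]]]; rewrite !fproj.
  by case: x => [i|i|i j|i j]; case: y => [i'|i'|i' j'|i' j'] //= _;
    rewrite ?[c == a]eq_sym //; lia.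
have f3 : ncolors f <= 3.
  have : {subset undup (codom (vsum f)) <= [:: a; s * b; c]}.
    move=> d; rewrite mem_undup => /codomP[B ->]; have [x ->] := projP B.
    by rewrite fproj !inE; case: x => *; rewrite /= eqxx ?orbT.
  exact: uniq_leq_size (undup_uniq _).
move=> h; apply: (chi_la_eq f_la f3) => g g_la.
case: h => [[_ bal] | <-]; last exact: chromatic_number_le_ncolors.
have k0 : 0 < 2 * k by lia.
pose i := Ordinal k0.
(* The image of any edge of H serves to select a component that contains an edge. *)
have uv : @adj (graphH k n) (U _ i) (V _ i) by rewrite /= adj_UV.
exact: balanced_ncolors bal (adj_proj tiP stabP uv) g_la.
Qed.
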